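(* Let $C\subset\mathbf{R}^3$ be the unit cube. There is a set $S$ of nine measurements, each of which is either the distance between two vertices or a face angle, such that $S$ determines $C$ up to congruence among polyhedra with the combinatorial structure of the cube: if $Q$ is any convex polyhedron combinatorially isomorphic to the cube, with a fixed combinatorial isomorphism from $C$ to $Q$, and each of the nine measurements in $S$ takes the same value on $Q$ as on $C$, then $Q$ is congruent to $C$.
   Context: A convex polyhedron is a bounded subset of $\mathbf{R}^3$, not contained in a plane, that is an intersection of finitely many closed half-spaces. A combinatorial isomorphism between two convex polyhedra consists of a bijection between their vertex sets and a bijection between their face sets such that a vertex lies on a face if and only if the corresponding vertex lies on the corresponding face. A face angle is the angle $\angle uvw\in[0,\pi]$ at $v$, where $u,v,w$ are three distinct vertices lying on a common face. A measurement specified in terms of vertices of $C$ is evaluated on $Q$ by using the corresponding vertices of $Q$. *)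

(* Defs.v *)
From HB Require Import structures.
From mathcomp Require Import all_boot all_order all_algebra.
From mathcomp Require Import all_classical all_reals all_analysis.

Set Implicit Arguments.
Unset Strict Implicit.
Unset Printing Implicit Defensive.

Import Order.TTheory GRing.Theory Num.Theory.
Import numFieldNormedType.Exports.

Local Open Scope classical_set_scope.
Local Open Scope ring_scope.

Section Polyhedra.
Variable R : realType.

Local Notation E3 := 'rV[R]_3.

(* The norm that the library puts on 'rV[R]_3 is the sup norm, so the Euclidean
   structure is introduced separately. *)
Definition dot (x y : E3) : R := \sum_(i < 3) x ord0 i * y ord0 i.

Definition enorm (x : E3) : R := Num.sqrt (dot x x).

Definition eucl_dist (x y : E3) : R := enorm (x - y).

(* The angle at v; used only for u != v and w != v. *)
Definition angle (u v w : E3) : R :=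
  acos (dot (u - v) (w - v) / (enorm (u - v) * enorm (w - v))).

Definition halfspace (a : E3) (b : R) : set E3 := [set x | dot a x <= b].

Definition plane (a : E3) (b : R) : set E3 := [set x | dot a x = b].

Definition line (p d : E3) : set E3 := [set p + t *: d | t in [set: R]].

(* bounded_set refers to the sup norm, which has the same bounded sets as the
   Euclidean norm. *)
Definition convex_polyhedron (P : set E3) : Prop :=
  [/\ bounded_set P,
      forall (a : E3) (b : R), a != 0 -> ~ (P `<=` plane a b) &
      exists (n : nat) (a : 'I_n -> E3) (b : 'I_n -> R),
        (forall i, a i != 0) /\ P = \bigcap_i halfspace (a i) (b i)].

Definition supports (a : E3) (b : R) (P : set E3) : Prop :=
  a != 0 /\ P `<=` halfspace a b.

Definition vertices (P : set E3) : set E3 :=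
  [set v | exists (a : E3) (b : R), supports a b P /\ P `&` plane a b = [set v]].

(* Faces are the two-dimensional ones.  A direction d = 0 is allowed, which is
   harmless since a single point lies on a line. *)
Definition faces (P : set E3) : set (set E3) :=
  [set F | exists (a : E3) (b : R), [/\ supports a b P, F = P `&` plane a b &
                           forall p d : E3, ~ (F `<=` line p d)]].

(* Only the values of phi on vertices and of psi on faces are relevant. *)
Definition combinatorial_iso (P Q : set E3)
    (phi : E3 -> E3) (psi : set E3 -> set E3) : Prop :=
  [/\ set_bij (vertices P) (vertices Q) phi,
      set_bij (faces P) (faces Q) psi &
      forall v F, vertices P v -> faces P F -> (F v <-> psi F (phi v))].

(* A measurement specified by vertices of P is represented by the function that
   sends a placement phi of these vertices to the value measured there: its
   value on P is at phi = id, and its value on Q is at the given correspondence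
   phi.  Hence exchanging the two ends of a distance, or the two sides of an
   angle, gives the same measurement. *)
Definition measurement := (E3 -> E3) -> R.

Definition distance_measurement (P : set E3) : set measurement :=
  [set m | exists u v, [/\ vertices P u, vertices P v, u != v &
                           m = fun phi => eucl_dist (phi u) (phi v)]].

Definition face_angle_measurement (P : set E3) : set measurement :=
  [set m | exists u v w,
     [/\ [/\ vertices P u, vertices P v & vertices P w],
         [/\ u != v, v != w & u != w],
         exists F, [/\ faces P F, F u, F v & F w] &
         m = fun phi => angle (phi u) (phi v) (phi w)]].

Definition unit_cube : set E3 := [set x | forall i, 0 <= x ord0 i <= 1].

Definition congruent (P Q : set E3) : Prop :=
  exists f : E3 -> E3,
    (forall x y, eucl_dist (f x) (f y) = eucl_dist x y) /\ f @` P = Q.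

End Polyhedra.

Arguments unit_cube : clear implicits.

(* Main.v *)
(* Fix a vertex O of the cube and measure its distances to its three neighbours
   and to the three opposite corners of the faces through O, together with the
   angles of these faces at those opposite corners.  If x, y are the edges at O
   and z the diagonal of one of these faces, then |x| = |y| = 1, |z|^2 = 2 and
   (x - z).(y - z) = 0 add up to |x + y - z|^2 = 0.  So the three faces at O are
   unit squares, without any planarity assumption, and seven vertices of Q are
   those of a unit cube.  The planes of the remaining faces pass through three
   of these vertices each, which places the eighth vertex.  The six face
   half-spaces bound Q by the cube, and convexity gives the other inclusion. *)
Require Import Defs.
From HB Require Import structures.
From mathcomp Require Import all_boot all_order all_algebra.
From mathcomp Require Import all_classical all_reals all_analysis.
From mathcomp Require Import ring lra.

Set Implicit Arguments.
Unset Strict Implicit.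
Unset Printing Implicit Defensive.

Import Order.TTheory GRing.Theory Num.Theory.
Import numFieldNormedType.Exports.

Local Open Scope classical_set_scope.
Local Open Scope ring_scope.

(** * Cyclic indexing of the three coordinates *)

Lemma ord3_ind (P : 'I_3 -> Prop) : P 0 -> P 1 -> P 2 -> forall k, P k.
Proof.
move=> P0 P1 P2 [[|[|[|//]]] lt_k3].
- by rewrite (_ : Ordinal _ = 0) //; apply/val_inj.
- by rewrite (_ : Ordinal _ = 1) //; apply/val_inj.
- by rewrite (_ : Ordinal _ = 2) //; apply/val_inj.
Qed.

Lemma ord3_neq (k : 'I_3) :
  ((k + 1 == k) = false) * ((k + 2 == k) = false) * ((k + 2 == k + 1) = false) *
  ((k == k + 1) = false) * ((k == k + 2) = false) * ((k + 1 == k + 2) = false).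
Proof. by elim/ord3_ind: k. Qed.

(** Addition in ['I_3] is modulo 3, so a distinguished axis [k] is followed cyclically by the other
    two and no case split on [k] is needed. *)
Lemma ord3_shift_ind (k : 'I_3) (P : 'I_3 -> Prop) :
  P k -> P (k + 1) -> P (k + 2) -> forall i, P i.
Proof.
move=> Pk Pk1 Pk2 i; rewrite -(subrK k i) addrC.
by elim/ord3_ind: (i - k); rewrite ?addr0.
Qed.

Lemma sum3 (V : nmodType) (F : 'I_3 -> V) (k : 'I_3) :
  \sum_i F i = F k + F (k + 1) + F (k + 2).
Proof.
have sum012 : \sum_i F i = F 0 + F 1 + F 2.
  rewrite !big_ord_recl big_ord0 addr0 addrA.
  by congr (_ + _ + _); congr F; apply/val_inj.
elim/ord3_ind: k; rewrite sum012.
- by rewrite !add0r.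
- have -> : 1 + 1 = 2 :> 'I_3 by apply/val_inj.
  have -> : 1 + 2 = 0 :> 'I_3 by apply/val_inj.
  by rewrite -[LHS]addrA [LHS]addrC.
have -> : 2 + 1 = 0 :> 'I_3 by apply/val_inj.
have -> : 2 + 2 = 1 :> 'I_3 by apply/val_inj.
by rewrite [LHS]addrC addrA.
Qed.

(** * Euclidean inner product and right angles *)

Section Euclid.
Variable R : realType.
Local Notation E3 := 'rV[R]_3.
Implicit Types (a x y z u v w p : E3) (k : 'I_3).

Lemma dot3 x y k :
  dot x y = x 0 k * y 0 k + x 0 (k + 1) * y 0 (k + 1) + x 0 (k + 2) * y 0 (k + 2).
Proof. exact: (sum3 (fun i => x 0 i * y 0 i) k). Qed.

Lemma dot_mulmx x y : dot x y = (x *m y^T) 0 0.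
Proof. by rewrite mxE; apply: eq_bigr => i _; rewrite mxE. Qed.

Lemma dotC x y : dot x y = dot y x.
Proof. by apply: eq_bigr => i _; rewrite mulrC. Qed.

Lemma dotDr x y z : dot x (y + z) = dot x y + dot x z.
Proof. by rewrite !dot_mulmx linearD mulmxDr mxE. Qed.

Lemma dot_mulmxr x y (E : 'M[R]_3) : dot x (y *m E) = dot (x *m E^T) y.
Proof. by rewrite !dot_mulmx trmx_mul mulmxA. Qed.

Lemma dot_ge0 x : 0 <= dot x x.
Proof. by apply: sumr_ge0 => i _; rewrite -expr2 sqr_ge0. Qed.

Lemma dot_eq0 x : dot x x = 0 -> x = 0.
Proof.
move=> /eqP; rewrite psumr_eq0 => [/allP x0|i _]; last by rewrite -expr2 sqr_ge0.
apply/rowP => i; rewrite mxE; apply/eqP.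
by have := x0 i (mem_index_enum i); rewrite /= mulf_eq0 orbb.
Qed.

Lemma sqr_eucl_dist x y : eucl_dist x y ^+ 2 = dot (x - y) (x - y).
Proof. by rewrite sqr_sqrtr ?dot_ge0. Qed.

Lemma enorm_gt0 x : x != 0 -> 0 < enorm x.
Proof.
move=> x0; rewrite sqrtr_gt0 lt_def dot_ge0 andbT.
by apply: contra_neq x0 => /dot_eq0.
Qed.

Lemma cauchy_schwarz x y : `|dot x y| <= enorm x * enorm y.
Proof.
rewrite -sqrtrM ?dot_ge0// -sqrtr_sqr ler_wsqrtr// !(dot3 _ _ 0) !add0r.
move: (x 0 0) (x 0 1) (x 0 2) (y 0 0) (y 0 1) (y 0 2) => a b c a' b' c'.
rewrite -subr_ge0.
set d := (X in 0 <= X).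
(* Lagrange's identity: the defect is the squared norm of the cross product. *)
have -> : d = (a * b' - b * a') ^+ 2 + (a * c' - c * a') ^+ 2
              + (b * c' - c * b') ^+ 2 by rewrite /d; ring.
by rewrite !addr_ge0 ?sqr_ge0.
Qed.

Lemma angle_right u v w :
  u != v -> w != v -> angle u v w = pi / 2 -> dot (u - v) (w - v) = 0.
Proof.
rewrite -subr_eq0 -[w == v]subr_eq0 /angle => /enorm_gt0 u0 /enorm_gt0 w0.
have uw0 := mulr_gt0 u0 w0.
set q := _ / _ => acos_q.
have : cos (acos q) = 0 by rewrite acos_q cos_pihalf.
(* [acos] is inverted by [cos] only on [-1, 1]; Cauchy-Schwarz puts the quotient there. *)
rewrite acosK; last first.
  rewrite in_itv/= -ler_norml normrM normfV (gtr0_norm uw0) ler_pdivrMr// mul1r.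
  exact: cauchy_schwarz.
by move=> /eqP; rewrite mulf_eq0 invr_eq0 (gt_eqF uw0) orbF => /eqP.
Qed.

(* The hypotheses say exactly that |x + y - z|^2 = 0. *)
Lemma square_completion x y z :
    dot x x = 1 -> dot y y = 1 -> dot z z = 2 -> dot (x - z) (y - z) = 0 ->
  z = x + y /\ dot x y = 0.
Proof.
move=> xx yy zz xyz.
have zxy : z = x + y.
  apply/eqP; rewrite eq_sym -subr_eq0; apply/eqP/dot_eq0.
  move: xx yy zz xyz; rewrite !(dot3 _ _ 0) !mxE; lra.
by split=> //; move: zz; rewrite zxy; move: xx yy; rewrite !(dot3 _ _ 0) !mxE; lra.
Qed.

End Euclid.

(** * Corners and faces of the unit cube *)

Section Cube.
Variable R : realType.
Local Notation E3 := 'rV[R]_3.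
Implicit Types (s t : 'I_3 -> bool) (k : 'I_3) (b : bool).

(** [pred0] encodes the base vertex O, [pred1 k] its neighbour along axis [k], [predC1 k] the corner
    opposite O in the face x_k = 0, and [xpredT] the antipode of O. *)
Definition corner s : E3 := \row_i (s i)%:R.

Definition cube_face k b : set E3 := [set x | unit_cube R x /\ x ord0 k = b%:R].

Lemma corner_ext s t : s =1 t -> corner s = corner t.
Proof. by move=> st; apply/rowP => i; rewrite !mxE st. Qed.

Lemma corner_inj s t : corner s = corner t -> s =1 t.
Proof.
move=> st i; have := congr1 (fun v : E3 => v 0 i) st; rewrite !mxE => /eqP.
by rewrite eqr_nat; do 2![case: (_ i)].
Qed.

Lemma corner_pred0 : corner pred0 = 0.
Proof. by apply/rowP => i; rewrite !mxE. Qed.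

Lemma unit_cube_corner s : unit_cube R (corner s).
Proof. by move=> i; rewrite mxE; case: (s i); rewrite /= ler01 lexx. Qed.

Lemma cube_face_corner k s : cube_face k (s k) (corner s).
Proof. by split; [exact: unit_cube_corner|rewrite mxE]. Qed.

Lemma unit_cube_vertex s : vertices (unit_cube R) (corner s).
Proof.
(* Twice the vector from the centre of the cube to the corner. *)
pose a : E3 := \row_i (if s i then 1 else - 1).
have le_a x i : unit_cube R x -> a ord0 i * x ord0 i <= (s i)%:R.
  by move=> /(_ i); rewrite mxE; case: (s i) => /=; lra.
exists a, (\sum_i (s i)%:R); split; first split.
- apply/eqP => /rowP/(_ 0); rewrite !mxE.
  by case: (s 0) => /eqP; rewrite ?oppr_eq0 oner_eq0.
- by move=> x Cx; apply: ler_sum => i _; exact: le_a.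
apply/seteqP; split => [x [Cx]|_ ->]; last first.
  split; first exact: unit_cube_corner.
  by apply: eq_bigr => i _; rewrite !mxE; case: (s i) => /=; lra.
rewrite /plane/= => /eqP dot_ax; apply/rowP => i; rewrite mxE.
(* Equality in a sum of termwise bounds forces equality in each coordinate. *)
have := leif_sum (fun i (_ : xpredT i) => leif_eq (le_a x i Cx)).
case=> _; rewrite -/(dot a x) dot_ax => /esym/forallP/(_ i)/= /eqP.
by rewrite mxE; case: (s i) => /=; lra.
Qed.

Lemma unit_cube_face k b : faces (unit_cube R) (cube_face k b).
Proof.
pose e : E3 := (if b then 1 else - 1) *: delta_mx 0 k.
have dot_e x : dot e x = (if b then 1 else - 1) * x 0 k.
  rewrite /dot (bigD1 k)//= !mxE !eqxx mulr1 big1 ?addr0// => i ik.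
  by rewrite !mxE (negPf ik) mulr0 mul0r.
exists e, b%:R; split; first split.
- apply/eqP => /rowP/(_ k); rewrite !mxE !eqxx mulr1.
  by case: b {e dot_e} => /eqP; rewrite ?oppr_eq0 oner_eq0.
- by move=> x /(_ k); rewrite /halfspace/= dot_e; case: b {e dot_e} => /=; lra.
- apply/seteqP; split => x [Cx]; rewrite /plane/= ?dot_e => xk; split => //;
    move: xk; rewrite ?dot_e; case: b {e dot_e} => /=; lra.
move=> p d sub_line.
(* [c k] is a corner of the face, [c (k + 1)] and [c (k + 2)] its two neighbours there; these three
   points are not collinear. *)
pose c (j : 'I_3) := corner (fun i => if i == k then b else i == j).
have in_line j : line p d (c j).
  apply: sub_line.
  by have := cube_face_corner k (fun i => if i == k then b else i == j); rewrite eqxx.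
have [t0 _ e0] := in_line k; have [t1 _ e1] := in_line (k + 1).
have [t2 _ e2] := in_line (k + 2).
have co j (t : R) i : p + t *: d = c j ->
    p 0 i + t * d 0 i = (if i == k then b else i == j)%:R.
  by move=> /rowP/(_ i); rewrite !mxE.
have := (co _ _ (k + 1) e0, co _ _ (k + 1) e1, co _ _ (k + 1) e2).
have := (co _ _ (k + 2) e0, co _ _ (k + 2) e1, co _ _ (k + 2) e2).
rewrite !ord3_neq !eqxx /=; case=> -[q0 q1] q2 [[r0 r1] r2].
have d2 : (t1 - t0) * d 0 (k + 2) = 0 by lra.
have d1 : (t1 - t0) * d 0 (k + 1) = 1 by lra.
have d3 : (t2 - t0) * d 0 (k + 2) = 1 by lra.
have /eqP := d2; rewrite mulf_eq0 => /orP[]/eqP z.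
  by move: d1 => /eqP; rewrite z mul0r eq_sym oner_eq0.
by move: d3 => /eqP; rewrite z mulr0 eq_sym oner_eq0.
Qed.

(* A linear form attains its maximum over the cube at the corner selecting the
   coordinates with nonnegative coefficient. *)
Lemma unit_cube_sub_halfspace (a : E3) (c : R) :
  (forall s, dot a (corner s) <= c) -> unit_cube R `<=` halfspace a c.
Proof.
move=> a_le x Cx; apply: le_trans (a_le (fun i => 0 <= a 0 i)).
apply: ler_sum => i _; rewrite mxE /=; have /andP[x0 x1] := Cx i.
case: (leP 0 (a 0 i)) => ai; first by rewrite mulr1 ler_piMr.
by rewrite mulr0 mulr_le0_ge0// ltW.
Qed.

(** * The nine measurements and their distinctness *)

Definition edge_dist k : measurement R :=
  fun phi => eucl_dist (phi (corner (pred1 k))) (phi (corner pred0)).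

Definition diagonal_dist k : measurement R :=
  fun phi => eucl_dist (phi (corner (predC1 k))) (phi (corner pred0)).

Definition opposite_angle k : measurement R :=
  fun phi => angle (phi (corner (pred1 (k + 1)))) (phi (corner (predC1 k)))
                   (phi (corner (pred1 (k + 2)))).

(** With this index type, the count of nine reduces to injectivity. *)
Definition nine_measurements (i : 'I_3 + 'I_3 + 'I_3) : measurement R :=
  match i with
  | inl (inl k) => edge_dist k
  | inl (inr k) => diagonal_dist k
  | inr k => opposite_angle k
  end.

Definition tip (i : 'I_3 + 'I_3) : 'I_3 -> bool :=
  match i with inl k => pred1 k | inr k => predC1 k end.

Lemma tip_inj i j : corner (tip i) = corner (tip j) -> i = j.
Proof.
move=> /corner_inj E; move: (E 0) (E 1) (E 2) => {E}.
by case: i => k; elim/ord3_ind: k; case: j => k; elim/ord3_ind: k.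
Qed.

Lemma tip_neq_pred0 i : corner (tip i) != corner pred0.
Proof.
apply/eqP => /corner_inj E; move: (E 0) (E 1) (E 2) => {E}.
by case: i => k; elim/ord3_ind: k.
Qed.

(* Separates the measurements: it moves the single point v. *)
Definition bump (v : E3) : E3 -> E3 := fun w => if w == v then delta_mx 0 0 else 0.

Lemma dot_delta0 : dot (delta_mx 0 0 : E3) (delta_mx 0 0) = 1.
Proof. by rewrite (dot3 _ _ 0) !mxE /=; lra. Qed.

Lemma nine_measurements_distE i :
  nine_measurements (inl i) =
  fun phi => eucl_dist (phi (corner (tip i))) (phi (corner pred0)).
Proof. by case: i. Qed.

Lemma dist_bump i j :
  nine_measurements (inl i) (bump (corner (tip j))) = (i == j)%:R.
Proof.
rewrite nine_measurements_distE /bump.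
rewrite [corner pred0 == _]eq_sym (negPf (tip_neq_pred0 j)) /eucl_dist subr0.
rewrite (inj_eq (@tip_inj)) /enorm.
case: (i == j); first by rewrite dot_delta0 sqrtr1.
by rewrite /dot big1 ?sqrtr0// => k _; rewrite mxE mul0r.
Qed.

(** If the apex is the moved point, both sides are the same vector; otherwise all three points
    coincide and the zero numerator gives [acos 0]. *)
Lemma angle_bump k l :
  opposite_angle k (bump (corner (predC1 l))) = if k == l then 0 else pi / 2.
Proof.
have pC j : (corner (pred1 j) == corner (predC1 l)) = false.
  by apply/negP => /eqP/(@tip_inj (inl j) (inr l)).
rewrite /opposite_angle /bump !pC.
have -> : (corner (predC1 k) == corner (predC1 l)) = (k == l).
  by apply/eqP/eqP => [/(@tip_inj (inr k) (inr l)) []|->].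
rewrite /angle; case: (k == l).
  rewrite sub0r /enorm.
  have -> : dot (- delta_mx 0 0 : E3) (- delta_mx 0 0) = 1.
    by rewrite -dot_delta0; apply: eq_bigr => i _; rewrite !mxE mulrNN.
  by rewrite sqrtr1 mulr1 divr1 acos1.
by rewrite subr0 /dot big1 ?mul0r ?acos0// => i _; rewrite mxE mul0r.
Qed.

Lemma nine_measurements_inj : injective nine_measurements.
Proof.
have pi2 : (pi / 2 : R) != 0 by rewrite gt_eqF// divr_gt0 ?pi_gt0.
have dist_angle i k : nine_measurements (inl i) <> nine_measurements (inr k).
  (* Collapsing all points to the origin makes every distance 0 and every angle [acos 0], which is
     [pi / 2]. *)
  move=> /(congr1 (fun m : measurement R => m (fun=> 0))).
  rewrite nine_measurements_distE /= /opposite_angle /eucl_dist /angle /enorm.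
  rewrite subrr /dot big1 => [|j _]; last by rewrite mxE mul0r.
  by rewrite sqrtr0 mul0r acos0 => /esym/eqP; rewrite (negPf pi2).
move=> [i|k] [j|l] E.
- have := congr1 (fun m : measurement R => m (bump (corner (tip j)))) E.
  rewrite !dist_bump eqxx => /eqP; rewrite eqr_nat.
  by case: (i =P j) => // ->.
- by case: (dist_angle _ _ E).
- by case: (dist_angle _ _ (esym E)).
- have := congr1 (fun m : measurement R => m (bump (corner (predC1 l)))) E.
  rewrite /= !angle_bump eqxx; case: eqP => [->//|_ /eqP].
  by rewrite (negPf pi2).
Qed.

Lemma card_nine_measurements : (range nine_measurements #= `I_9)%card.
Proof.
apply: card_eq_trans (inj_card_eq (in2W nine_measurements_inj)) _.
have c9 : #|{: 'I_3 + 'I_3 + 'I_3}| = 9%N by rewrite !card_sum !card_ord.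
apply: card_esym; apply: card_eq_trans card_II _.
pose f (i : 'I_9) : 'I_3 + 'I_3 + 'I_3 := enum_val (cast_ord (esym c9) i).
have f_inj : injective f by move=> i j /enum_val_inj/cast_ord_inj.
suff <- : range f = setT by exact: card_esym (inj_card_eq (in2W f_inj)).
apply/seteqP; split => // x _.
by exists (cast_ord c9 (enum_rank x)) => //; rewrite /f cast_ordK enum_rankK.
Qed.

Lemma nine_measurements_sub :
  range nine_measurements `<=`
  distance_measurement (unit_cube R) `|` face_angle_measurement (unit_cube R).
Proof.
move=> _ [[i|k] _ <-]; [left|right].
  rewrite nine_measurements_distE; exists (corner (tip i)), (corner pred0).
  by split => //; [exact: unit_cube_vertex..|exact: tip_neq_pred0].
exists (corner (pred1 (k + 1))), (corner (predC1 k)), (corner (pred1 (k + 2))).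
split.
- by split; exact: unit_cube_vertex.
- split; apply/eqP.
  + by move/(@tip_inj (inl _) (inr _)).
  + by move/(@tip_inj (inr _) (inl _)).
  + by move/(@tip_inj (inl _) (inl _)) => -[]; elim/ord3_ind: k.
- exists (cube_face k false); split; first exact: unit_cube_face.
  + have -> : false = pred1 (k + 1) k by elim/ord3_ind: k.
    exact: cube_face_corner.
  + have -> : false = predC1 k k by rewrite /= eqxx.
    exact: cube_face_corner.
  + have -> : false = pred1 (k + 2) k by elim/ord3_ind: k.
    exact: cube_face_corner.
- by [].
Qed.

(** * Constraints on a polyhedron with the combinatorics of the cube *)

(** The face assigned by [psi] supplies the supporting plane, and incidence puts the images of the
    four corners on it. *)
Lemma iso_support Q phi psi k b : combinatorial_iso (unit_cube R) Q phi psi ->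
  exists a c, [/\ a != 0, Q `<=` halfspace a c &
    forall s, s k = b -> dot a (phi (corner s)) = c].
Proof.
move=> [_ [face_psi _ _] incid].
have [a [c [[a0 Qac] psiE _]]] := face_psi _ (unit_cube_face k b).
exists a, c; split => // s sk.
have := cube_face_corner k s; rewrite sk.
move/(incid _ _ (unit_cube_vertex s) (unit_cube_face k b)).
by rewrite psiE => -[].
Qed.

Lemma iso_vertex_in Q phi psi s :
  combinatorial_iso (unit_cube R) Q phi psi -> Q (phi (corner s)).
Proof.
move=> [[vert_phi _ _] _ _].
have [a [c [_ QE]]] := vert_phi _ (unit_cube_vertex s).
have : [set phi (corner s)] (phi (corner s)) by [].
by rewrite -QE => -[].
Qed.

Lemma dot_corner (a : E3) s k :
  dot a (corner s) =
  a 0 k * (s k)%:R + a 0 (k + 1) * (s (k + 1))%:R + a 0 (k + 2) * (s (k + 2))%:R.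
Proof. by rewrite (dot3 _ _ k) !mxE. Qed.

Lemma corner_mulmx s k (E : 'M[R]_3) :
  corner s *m E = (s k)%:R *: row k E + (s (k + 1))%:R *: row (k + 1) E
                  + (s (k + 2))%:R *: row (k + 2) E.
Proof. by rewrite mulmx_sum_row (sum3 _ k) !mxE. Qed.

Lemma nine_measurements_id :
  [/\ forall k, edge_dist k id ^+ 2 = 1,
      forall k, diagonal_dist k id ^+ 2 = 2 &
      forall k, opposite_angle k id = pi / 2].
Proof.
split=> k; rewrite /edge_dist /diagonal_dist ?sqr_eucl_dist.
- by rewrite corner_pred0 subr0 (dot_corner _ _ k) !mxE /= !eqxx !ord3_neq /=; lra.
- by rewrite corner_pred0 subr0 (dot_corner _ _ k) !mxE /= !eqxx !ord3_neq /=; lra.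
rewrite /opposite_angle /angle (dot3 _ _ k) !mxE /= !eqxx !ord3_neq /=.
by rewrite !subrr !mul0r mulr0 !addr0 mul0r acos0.
Qed.

(** The rows of [E] are the images of the edges at O, orthonormal because the faces at O become unit
    squares. The condition [s k = false] places the corner on such a face, which excludes only the
    antipode of O. *)
Lemma nine_measurements_frame (phi : E3 -> E3) :
    (forall i, nine_measurements i phi = nine_measurements i id) ->
  exists E : 'M[R]_3, E *m E^T = 1%:M /\
    forall s k, s k = false ->
      phi (corner s) = phi (corner pred0) + corner s *m E.
Proof.
move=> phi_eq; set p := phi (corner pred0).
have [edge_id diag_id angle_id] := nine_measurements_id.
pose e k := phi (corner (pred1 k)) - p.
pose f k := phi (corner (predC1 k)) - p.
have ee k : dot (e k) (e k) = 1.
  rewrite -sqr_eucl_dist -(edge_id k); congr (_ ^+ 2).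
  exact: (phi_eq (inl (inl k))).
have ff k : dot (f k) (f k) = 2.
  rewrite -sqr_eucl_dist -(diag_id k); congr (_ ^+ 2).
  exact: (phi_eq (inl (inr k))).
(* The squared distances 1 and 2 from [p] keep these points apart, so the angles are
   nondegenerate. *)
have e_neq_f j k : phi (corner (pred1 j)) != phi (corner (predC1 k)).
  by apply/eqP => ef; have := ff k; rewrite /f -ef ee => /eqP; rewrite (eqr_nat _ 1 2).
have sq k : f k = e (k + 1) + e (k + 2) /\ dot (e (k + 1)) (e (k + 2)) = 0.
  apply: square_completion => //.
  have subBB (u v : E3) : u - p - (v - p) = u - v by rewrite opprB addrA subrK.
  rewrite /e /f !subBB.
  apply: angle_right (e_neq_f _ _) (e_neq_f _ _) _.
  by rewrite -(angle_id k); exact: (phi_eq (inr k)).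
(* The two relations come from the faces with normal axes [k + 2] and [k + 1], with indices reduced
   modulo 3. *)
have e_orth k : dot (e k) (e (k + 1)) = 0 /\ dot (e k) (e (k + 2)) = 0.
  have [_] := sq (k + 2); have [_] := sq (k + 1).
  have -> : k + 1 + 1 = k + 2 by elim/ord3_ind: (k); apply/val_inj.
  have -> : k + 1 + 2 = k by elim/ord3_ind: (k); apply/val_inj.
  have -> : k + 2 + 1 = k by elim/ord3_ind: (k); apply/val_inj.
  have -> : k + 2 + 2 = k + 1 by elim/ord3_ind: (k); apply/val_inj.
  by rewrite (dotC (e (k + 2))).
exists (\matrix_k e k); split.
  apply/matrixP => i j; rewrite !mxE.
  have -> : \sum_l (\matrix_k e k) i l * (\matrix_k e k)^T l j = dot (e i) (e j).
    by apply: eq_bigr => l _; rewrite !mxE.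
  by move: j; apply: (@ord3_shift_ind i); rewrite ?eqxx ?ord3_neq ?ee; case: (e_orth i).
move=> s k sk; rewrite (corner_mulmx _ k) !rowK sk scale0r add0r.
have E t : s k = t k -> s (k + 1) = t (k + 1) -> s (k + 2) = t (k + 2) ->
    corner s = corner t.
  by move=> *; apply: corner_ext => i; move: i; apply: (@ord3_shift_ind k).
case s1: (s (k + 1)); case s2: (s (k + 2)); rewrite ?scale1r ?scale0r ?addr0 ?add0r.
- have -> : corner s = corner (predC1 k).
    by apply: E; rewrite ?sk ?s1 ?s2 /= ?eqxx ?ord3_neq.
  by have [<- _] := sq k; rewrite /f [RHS]addrC subrK.
- have -> : corner s = corner (pred1 (k + 1)).
    by apply: E; rewrite ?sk ?s1 ?s2 /= ?eqxx ?ord3_neq.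
  by rewrite /e [RHS]addrC subrK.
- have -> : corner s = corner (pred1 (k + 2)).
    by apply: E; rewrite ?sk ?s1 ?s2 /= ?eqxx ?ord3_neq.
  by rewrite /e [RHS]addrC subrK.
- by congr phi; apply: E; rewrite ?sk ?s1 ?s2.
Qed.

(* Three noncollinear corners fix the plane of a facet up to scaling, and a
   corner off that plane fixes the sign. *)
Lemma facet_form (a : E3) (c : R) k b : a != 0 ->
    (forall s j, s j = false -> dot a (corner s) <= c) ->
    (forall s j, s j = false -> s k = b -> dot a (corner s) = c) ->
  exists2 l, 0 < l &
    forall x : E3, dot a x - c = l * (if b then x 0 k - 1 else - x 0 k).
Proof.
move=> a0 a_le a_eq.
have a_neq0 : a 0 (k + 1) = 0 -> a 0 (k + 2) = 0 -> a 0 k != 0.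
  move=> a1 a2; apply: contra_neq a0 => ak.
  by apply/rowP => i; rewrite mxE; move: i; apply: (@ord3_shift_ind k).
case: b a_eq => a_eq.
  (* The antipode of O, fourth corner of the face x_k = 1, is not yet placed; the other three
     corners are used, and O gives the sign. *)
  have := a_eq (pred1 k) (k + 1).
  have := a_eq (predC1 (k + 1)) (k + 1).
  have := a_eq (predC1 (k + 2)) (k + 2).
  have := a_le pred0 k.
  rewrite !(dot_corner _ _ k) /= !eqxx !ord3_neq /=.
  move=> /(_ erefl) c_ge /(_ erefl erefl) c2 /(_ erefl erefl) c1 /(_ erefl erefl) c0.
  have a1 : a 0 (k + 1) = 0 by lra.
  have a2 : a 0 (k + 2) = 0 by lra.
  exists (a 0 k); first by rewrite lt_def a_neq0//=; lra.
  by move=> x; rewrite (dot3 _ _ k) a1 a2; lra.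
have := a_eq pred0 k.
have := a_eq (pred1 (k + 1)) k.
have := a_eq (pred1 (k + 2)) k.
have := a_le (pred1 k) (k + 1).
rewrite !(dot_corner _ _ k) /= !eqxx !ord3_neq /=.
move=> /(_ erefl) c_ge /(_ erefl erefl) c2 /(_ erefl erefl) c1 /(_ erefl erefl) c0.
have a1 : a 0 (k + 1) = 0 by lra.
have a2 : a 0 (k + 2) = 0 by lra.
exists (- a 0 k); first by rewrite lt_def oppr_eq0 a_neq0//=; lra.
by move=> x; rewrite (dot3 _ _ k) a1 a2; lra.
Qed.

End Cube.

Theorem mainTheorem2 (R : realType) :
  exists S : set (measurement R),
    [/\ (S #= `I_9)%card,
        S `<=` distance_measurement (unit_cube R)
               `|` face_angle_measurement (unit_cube R) &
        forall (Q : set 'rV[R]_3) (phi : 'rV[R]_3 -> 'rV[R]_3)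
               (psi : set 'rV[R]_3 -> set 'rV[R]_3),
          convex_polyhedron Q ->
          combinatorial_iso (unit_cube R) Q phi psi ->
          (forall m, S m -> m phi = m id) ->
          congruent Q (unit_cube R)].
Proof.
exists (range (@nine_measurements R)); split.
- exact: card_nine_measurements.
- exact: nine_measurements_sub.
move=> Q phi psi [_ _ [n [a [c [_ QE]]]]] iso same.
have [|E [EET phiE]] := @nine_measurements_frame _ phi.
  by move=> i; apply: same; exists i.
have ETE := mulmx1C EET.
set p := phi (corner R pred0) in phiE.
(* The inverse of the rigid motion y -> p + yE: it takes the image of O to the origin and the image
   edges to the axes. *)
pose chart x := (x - p) *m E^T.
have dot_chart u x : dot u x = dot u p + dot (u *m E^T) (chart x).
  by rewrite dot_mulmxr trmxK -mulmxA ETE mulmx1 -dotDr addrC subrK.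
have chartK y : chart (p + y *m E) = y.
  by rewrite /chart addrC addKr -mulmxA EET mulmx1.
have chart_corner s k : s k = false -> chart (phi (corner R s)) = corner R s.
  by move=> sk; rewrite (phiE _ _ sk) chartK.
(* In the chart, the supporting half-space for each face becomes that of the cube. The second clause
   covers all four corners of the face, including the antipode. *)
have facet k b : exists2 l, 0 < l &
    (forall x, Q x -> l * (if b then chart x 0 k - 1 else - chart x 0 k) <= 0) /\
    (forall s, s k = b -> l * (if b then chart (phi (corner R s)) 0 k - 1
                               else - chart (phi (corner R s)) 0 k) = 0).
  have [u [d [u0 Qud face_u]]] := iso_support k b iso.
  have [|s j sj|s j sj sk|l l0 form] := @facet_form _ (u *m E^T) (d - dot u p) k b.
  - by apply: contra_neq u0 => u0; rewrite -[u]mulmx1 -ETE mulmxA u0 mul0mx.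
  - have := Qud _ (iso_vertex_in s iso).
    by rewrite /halfspace/= dot_chart (chart_corner _ _ sj); lra.
  - by have := face_u _ sk; rewrite dot_chart (chart_corner _ _ sj); lra.
  exists l => //; split => [x /Qud|s /face_u];
    by rewrite /halfspace/= dot_chart -form => Hx; lra.
have chart_le x k : Q x -> 0 <= chart x 0 k <= 1.
  move=> Qx; have [l l0 [/(_ x Qx) le1 _]] := facet k true.
  have [l' l'0 [/(_ x Qx) le0 _]] := facet k false.
  by move: le0 le1; rewrite !pmulr_rle0//; lra.
(* The antipode lies on all three planes x_k = 1. *)
have chart_top : chart (phi (corner R xpredT)) = corner R xpredT.
  apply/rowP => k; have [l l0 [_ /(_ xpredT erefl) /eqP]] := facet k true.
  by rewrite mulf_eq0 gt_eqF//= subr_eq0 => /eqP ->; rewrite mxE.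
have chartV x : p + chart x *m E = x.
  by rewrite /chart -mulmxA ETE mulmx1 addrC subrK.
have phi_corner s : phi (corner R s) = p + corner R s *m E.
  have [/existsP[k /negPf sk]|/existsPn sT] := boolP [exists k, ~~ s k].
    exact: phiE sk.
  have -> : corner R s = corner R xpredT.
    by apply: corner_ext => k; have := sT k; rewrite negbK.
  by rewrite -[LHS]chartV chart_top.
exists chart; split.
  move=> x y; rewrite /eucl_dist /enorm /chart -mulmxBl dot_mulmxr trmxK.
  by rewrite -mulmxA ETE mulmx1 opprB addrA subrK.
apply/seteqP; split => [_ [x Qx <-] k|y Cy]; first exact: chart_le.
exists (p + y *m E) => //; rewrite QE => i _; rewrite /halfspace/= dotDr dot_mulmxr.
(* Each half-space defining [Q] contains the images of all eight corners, hence that of the whole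
   cube. *)
rewrite -lerBrDl; apply: (unit_cube_sub_halfspace _ Cy) => s.
have := iso_vertex_in s iso; rewrite {1}QE => /(_ i I).
by rewrite /halfspace/= phi_corner dotDr dot_mulmxr -lerBrDl.
Qed.
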